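(* Let $X$ be a Polish space, $\rho$ a diffuse locally finite measure on $X$, $(Y_t)_{0\le t<1}$ the spatial Chinese restaurant-like process with parameter $\rho$, $B\subset X$ a bounded Borel set, and $U_{B,t}=U_B(Y_t)$. Then the generator of the Markov process $(U_{B,t})_{0\le t<1}$ is given, for $0\le s<1$, $f:\mathcal M^{\cdot\cdot}_f(\mathbb N)\to\mathbb R$ measurable and bounded, and $\eta\in\mathcal M^{\cdot\cdot}_f(\mathbb N)$, by $$\mathcal A^B_s f(\eta)=\frac{\rho(B)}{1-s}\bigl[f(\eta+\delta_1)-f(\eta)\bigr]+\frac1{1-s}\sum_{j\ge1}j\,\eta(j)\bigl[f(\eta-\delta_j+\delta_{j+1})-f(\eta)\bigr].$$
   Context: $\mathbb N=\{1,2,\dots\}$; $\mathcal M^{\cdot\cdot}_f(\mathbb N)$ is the set of finite point measures on $\mathbb N$; $\eta(j)$ is the weight of $\eta$ at $j$; summands with $\eta(j)=0$ are zero. $X$ is a Polish space with its bounded Borel sets; $\mathcal M(X)$ is the space of locally finite measures (finite on bounded sets) with the vague topology, $\mathcal M^{\cdot\cdot}(X)$ its closed subset of point measures. Pólya sum process: for $z\in[0,1)$ and $\kappa\in\mathcal M(X)$, $\mathsf S_{z,\kappa}$ denotes the unique law on $\mathcal M^{\cdot\cdot}(X)$ satisfying, for all measurable $h\ge 0$, $\iint h(x,\mu)\,\mu(\mathrm dx)\,\mathsf S_{z,\kappa}(\mathrm d\mu)=\iint h(x,\mu+\delta_x)\,z(\kappa+\mu)(\mathrm dx)\,\mathsf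 S_{z,\kappa}(\mathrm d\mu)$. Spatial Chinese restaurant-like process with parameter $\rho\in\mathcal M(X)$: the Markov process $(Y_t)_{0\le t<1}$ with values in $\mathcal M^{\cdot\cdot}(X)$ and càdlàg, increasing paths ($Y_s\le Y_t$ for $s\le t$) such that $Y_0=0$ and, for $0\le s<t<1$, the conditional law of $Y_t-Y_s$ given $Y_s$ is $\mathsf S_{\frac{t-s}{1-s},\,\rho+Y_s}$. For $\mu\in\mathcal M^{\cdot\cdot}(X)$, $U_B(\mu)\in\mathcal M^{\cdot\cdot}_f(\mathbb N)$ has weight at $j$ equal to the number of $x\in B$ with $\mu(\{x\})=j$. The process $(U_{B,t})_t$ is Markov with transition kernel $p^B_{s,t}(\eta,f)=\int f(U_B(\mu+\nu))\,\mathsf S_{\frac{t-s}{1-s},\rho+\nu}(\mathrm d\mu)$ for any $\nu\in\mathcal M^{\cdot\cdot}(X)$ with $U_B(\nu)=\eta$. Its generator (a time-dependent family) is the pointwise limit $\mathcal A^B_sf(\eta)=\lim_{h\downarrow0}\frac1h\bigl[p^B_{s,s+h}(\eta,f)-f(\eta)\bigr]$.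
   Formalization: The identity is stated for those η that equal U_B(ν) for some point measure ν; for other η (possible only when B is finite, e.g. B empty and η=δ_1) the kernel p^B, hence the generator, is undefined. *)

(* Defs.v *)
From HB Require Import structures.
From mathcomp Require Import all_boot all_order all_algebra finmap multiset.
From mathcomp Require Import all_classical all_reals all_analysis.
From mathcomp Require Import measurable_realfun.

Set Implicit Arguments.
Unset Strict Implicit.
Unset Printing Implicit Defensive.

Import Order.TTheory GRing.Theory Num.Theory.
Import numFieldNormedType.Exports.

Local Open Scope classical_set_scope.
Local Open Scope ring_scope.

HB.mixin Record isSeparable T & Topological T := {
  separable : exists2 D : set T, countable D & dense D
}.

(* A Polish space together with the complete metric that fixes which sets are
   bounded. *)
#[short(type="polishType")]
HB.structure Definition Polish (R : realType) :=
  {X of Pointed X & Complete X & Metric R X & isSeparable X}.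

Notation borel T := (g_sigma_algebraType (@open T)).

Section locally_finite_measures.
Context {R : realType} (X : polishType R).

Definition metric_bounded (B : set X) := exists x r, B `<=` ball x r.

Definition bounded_borel (B : set (borel X)) :=
  measurable B /\ metric_bounded B.

Record lfMeasure := LfMeasure {
  lf_val :> {measure set (borel X) -> \bar R} ;
  lf_finite : forall B, bounded_borel B -> (lf_val B < +oo)%E }.

HB.instance Definition _ := gen_eqMixin lfMeasure.
HB.instance Definition _ := gen_choiceMixin lfMeasure.

Record vague_test := VagueTest {
  vtest :> X -> R ;
  vtest_continuous : continuous vtest ;
  vtest_bounded : exists M, forall x, `|vtest x| <= M ;
  vtest_support : metric_bounded [set x | vtest x != 0] }.

Definition vague_eval (mu : lfMeasure) : prod_topology (fun _ : vague_test => R) :=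
  fun g => (\int[mu]_x g x)%R.

HB.instance Definition _ :=
  Topological.copy lfMeasure (initial_topology vague_eval).

Record pointMeasure := PointMeasure {
  pm_val :> lfMeasure ;
  pm_integer : forall B, bounded_borel B ->
    exists n : nat, pm_val B = n%:R%:E }.

HB.instance Definition _ := gen_eqMixin pointMeasure.
HB.instance Definition _ := gen_choiceMixin pointMeasure.

Fact pm0_finite B : bounded_borel B -> (@mzero _ (borel X) R B < +oo)%E.
Proof. by move=> _; rewrite /mzero ltry. Qed.

Fact pm0_integer B : bounded_borel B ->
  exists n : nat, LfMeasure pm0_finite B = n%:R%:E.
Proof. by exists 0%N. Qed.

Definition pm0 := PointMeasure pm0_integer.

HB.instance Definition _ := isPointed.Build pointMeasure pm0.
HB.instance Definition _ :=
  Topological.copy pointMeasure (initial_topology pm_val).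
HB.instance Definition _ := Measurable.copy pointMeasure (borel pointMeasure).

Fact lf_add_finite (mu nu : lfMeasure) B : bounded_borel B ->
  (measure_add mu nu B < +oo)%E.
Proof.
move=> bB; rewrite (measure_addE mu nu B) lte_add_pinfty//; exact: lf_finite.
Qed.

Definition lf_add (mu nu : lfMeasure) := LfMeasure (@lf_add_finite mu nu).

Fact pm_add_integer (mu nu : pointMeasure) B : bounded_borel B ->
  exists n : nat, lf_add mu nu B = n%:R%:E.
Proof.
move=> bB; have [m mE] := pm_integer mu bB; have [n nE] := pm_integer nu bB.
exists (m + n)%N; rewrite natrD EFinD -mE -nE.
exact: (measure_addE mu nu B).
Qed.

Definition pm_add (mu nu : pointMeasure) := PointMeasure (@pm_add_integer mu nu).

(* The difference [mu - nu] when [nu <= mu]; pointwise subtraction would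
   produce [+oo - +oo] on unbounded sets. *)
Definition pm_sub (mu nu : pointMeasure) : pointMeasure :=
  get [set k | pm_add nu k = mu].

Fact pm_dirac_finite (x : X) B : bounded_borel B ->
  (@dirac _ (borel X) x R B < +oo)%E.
Proof. by move=> _; rewrite diracE ltry. Qed.

Fact pm_dirac_integer (x : X) B : bounded_borel B ->
  exists n : nat, LfMeasure (@pm_dirac_finite x) B = n%:R%:E.
Proof. by move=> _; exists (x \in B); rewrite /= diracE. Qed.

Definition pm_dirac (x : X) := PointMeasure (@pm_dirac_integer x).

Definition diffuse (rho : lfMeasure) := forall x : X, rho [set x] = 0%E.

Definition is_polya_sum (z : R) (kappa : lfMeasure)
    (Q : probability pointMeasure R) : Prop :=
  forall h : borel X * pointMeasure -> \bar R,
    measurable_fun setT h -> (forall u, 0 <= h u)%E ->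
    (\int[Q]_mu \int[mu]_x h (x, mu) =
     \int[Q]_mu (z%:E *
       \int[lf_add kappa mu]_x h (x, pm_add mu (pm_dirac x))))%E.

End locally_finite_measures.

Section processes.
Context {R : realType} d (Omega : measurableType d) (P : probability Omega R).
Context d' (T : measurableType d').
Implicit Type Z : R -> Omega -> T.

Definition past Z (s : R) : set (set Omega) :=
  <<s [set E | exists r A,
         [/\ 0 <= r <= s, measurable A & E = Z r @^-1` A]] >>.

(* Time runs over [0, 1); values of a process outside it are irrelevant. *)
Definition markov_process Z : Prop :=
  forall (s t : R) (A : set T), 0 <= s -> s <= t -> t < 1 -> measurable A ->
  exists k : T -> \bar R,
    [/\ measurable_fun setT k, (forall y, 0 <= k y)%E &
     forall E, past Z s E ->
       P (E `&` Z t @^-1` A) = (\int[P]_(w in E) k (Z s w))%E].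

Definition markov_kernel Z (p : R -> R -> T -> (T -> R) -> R) : Prop :=
  forall (s t : R) (f : T -> R) E, 0 <= s -> s <= t -> t < 1 ->
    measurable_fun setT f -> bounded_fun f -> past Z s E ->
    (\int[P]_(w in E) f (Z t w) = \int[P]_(w in E) p s t (Z s w) f)%R.

End processes.

Record is_spatial_crp {R : realType} {X : polishType R}
    (S : R -> lfMeasure X -> probability (pointMeasure X) R)
    (rho : lfMeasure X) d (Omega : measurableType d) (P : probability Omega R)
    (Y : R -> Omega -> pointMeasure X) : Prop := IsSpatialCRP {
  scrp_measurable : forall t : R, 0 <= t < 1 -> measurable_fun setT (Y t) ;
  scrp_start : forall w, Y 0 w = pm0 X ;
  scrp_increasing : forall w (s t : R), 0 <= s -> s <= t -> t < 1 ->
    forall A : set (borel X), measurable A -> (Y s w A <= Y t w A)%E ;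
  scrp_right_continuous : forall w (t : R), 0 <= t < 1 ->
    Y u w @[u --> t^'+] --> Y t w ;
  scrp_left_limits : forall w (t : R), 0 < t < 1 -> cvg (Y u w @[u --> t^'-]) ;
  scrp_markov : markov_process P Y ;
  scrp_increments : forall (s t : R) (C A : set (pointMeasure X)),
    0 <= s -> s < t -> t < 1 -> measurable C -> measurable A ->
    P (Y s @^-1` C `&` [set w | A (pm_sub (Y t w) (Y s w))]) =
    (\int[P]_(w in Y s @^-1` C)
       S ((t - s) / (1 - s))%R (lf_add rho (Y s w)) A)%E }.

Definition posnat := {j : nat | (0 < j)%N}.

Definition posnat1 : posnat := exist _ 1%N isT.

Definition posnat_succ (j : posnat) : posnat := exist _ (val j).+1 isT.

(* A finite point measure on the positive integers is a finite multiset of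
   positive integers, its weight at [j] being the multiplicity of [j]. *)
Definition countMeasure := {mset posnat}%mset.

HB.instance Definition _ := Choice.on countMeasure.
HB.instance Definition _ := isPointed.Build countMeasure mset0%mset.

Definition count_evaluations : set (set countMeasure) :=
  [set A | exists (j : posnat) (n : nat), A = [set eta : countMeasure | eta j = n]].

HB.instance Definition _ :=
  Measurable.copy countMeasure (g_sigma_algebraType count_evaluations).

Section counts.
Context {R : realType} {X : polishType R}.
Implicit Types (B : set X) (mu : pointMeasure X).

Definition sites B mu (j : posnat) : set X :=
  [set x | B x /\ mu [set x] = (val j)%:R%:E].

(* For bounded [B] the set of relevant [j] and all [sites B mu j] are finite;
   [fset_set] is only meaningful on finite sets. *)
Definition counts B mu : countMeasure :=
  [fsfun j in fset_set [set j | sites B mu j !=set0]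
     => #|` fset_set (sites B mu j) | | 0%N].

Variable S : R -> lfMeasure X -> probability (pointMeasure X) R.

(* [p s t eta f] is constrained only at those [eta] which are of the form
   [counts B nu]. *)
Definition is_count_kernel (rho : lfMeasure X) B
    (p : R -> R -> countMeasure -> (countMeasure -> R) -> R) : Prop :=
  forall (s t : R) (f : countMeasure -> R) (nu : pointMeasure X),
    0 <= s -> s <= t -> t < 1 -> measurable_fun setT f -> bounded_fun f ->
    p s t (counts B nu) f =
    (\int[S ((t - s) / (1 - s)) (lf_add rho nu)]_mu
       f (counts B (pm_add mu nu)))%R.

End counts.

Definition has_generator_at {R : realType} {T : Type}
    (p : R -> R -> T -> (T -> R) -> R) (s : R) (f : T -> R) (eta : T)
    (a : R) : Prop :=
  h^-1 * (p s (s + h) eta f - f eta) @[h --> 0^'+] --> a.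

(* Main.v *)
Require Import Defs.
From HB Require Import structures.
From mathcomp Require Import all_boot all_order all_algebra finmap multiset.
From mathcomp Require Import all_classical all_reals all_analysis.
From mathcomp Require Import measurable_realfun.
From mathcomp Require Import ring lra.

Set Implicit Arguments.
Unset Strict Implicit.
Unset Printing Implicit Defensive.

Import Order.TTheory GRing.Theory Num.Theory.
Import numFieldNormedType.Exports.

Local Open Scope classical_set_scope.
Local Open Scope ring_scope.

(** The kernel [p s (s + h)] integrates [f (counts B (mu + nu))] against the
    Polya sum law [Q] with parameters [z = h / (1 - s)] and [kappa = rho + nu],
    where [nu] is any point measure with [counts B nu = eta].  The generator is
    read off from the first-order expansion of this integral in [z].

    Put [N = mu B].  Testing the defining equation of [Q] against
    [h (x, mu) = 1_C(x) phi(N)], with [C] inside [B], gives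
    [E (phi(N) mu(C)) = z E (phi(N + 1) (kappa(C) + mu(C)))]
    ([polya_count_identity]).  Two choices of [phi] suffice:
    - [phi = 1_{1}] gives [Q (N = 1, mu C = 1) = z kappa(C) Q (N = 0)]
      ([polya_one_point]);
    - [phi(r) = 1_{r >= n + 1} / r] gives
      [Q (N >= n + 1) <= z (kappa B + 1) Q (N >= n)] ([polya_atleast]), so
      that [Q (N >= 1) = O(z)] and [Q (N >= 2) = O(z^2)].

    Hence, up to [O(z^2)], either nothing is added inside [B], or one point is.
    Let [a_1, ..., a_r] be the atoms of [nu] in [B].  The added point falls on
    [a_i] with probability [z nu{a_i} Q (N = 0)], as [rho] is diffuse, and an
    atom of mass [j] becomes one of mass [j + 1]; it falls off all atoms with
    probability [z rho(B) Q (N = 0)], and creates an atom of mass 1.  Grouping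
    the atoms by their mass turns the sum over [i] into
    [sum_j j eta(j) (f (eta - delta_j + delta_(j+1)) - f eta)]
    ([sum_counts], [polya_first_order]).

    Two facts support this computation.  Evaluations [mu |-> mu C] on bounded
    Borel sets are measurable for the Borel sets of the vague topology
    ([measurable_eval]): indicators of open sets are increasing limits of
    continuous functions, and a monotone class argument extends this to Borel
    sets.  And a point measure is purely atomic on bounded sets
    ([atom_decomposition_exists]), because the space is separable. *)

(** * Evaluations of point measures on bounded Borel sets *)

Lemma continuous_borel_measurable (R : realType) (T : ptopologicalType)
    (f : T -> R) : continuous f -> measurable_fun setT (f : borel T -> R).
Proof.
move=> /continuousP cf.
apply: (measurability _ (RGenOInfty.measurableE R)).
move=> _ [_ [a ->] <-]; rewrite setTI; apply: sub_sigma_algebra.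
by apply: cf; exact: interval_open.
Qed.

Section separation.
Context {R : realType} (X : polishType R).
Implicit Types (O : set X).

Lemma edist_inf_fin_num (A : set X) (x : X) :
  A !=set0 -> edist_inf A x \is a fin_num.
Proof.
move=> [y Ay]; rewrite ge0_fin_numE ?edist_inf_ge0//.
apply: (@le_lt_trans _ _ (edist (x, y))).
  by apply: ereal_inf_lbound; exists y.
rewrite -ge0_fin_numE ?edist_ge0//; apply/edist_finP => /=.
exists (mdist x y + 1); first by rewrite ltr_wpDl// mdist_ge0.
by rewrite ballEmdist/= ltrDl.
Qed.

(** The distance to the complement of [O]; it is infinite when [O] is the whole
    space, where the constant 1 replaces it. *)
Lemma open_positivity_set O : open O -> exists phi : X -> R,
  [/\ continuous phi, forall x, 0 <= phi x & forall x, 0 < phi x <-> O x].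
Proof.
move=> oO; have [cO0|/set0P nO] := eqVneq (~` O) set0.
  exists (cst 1); split=> [x|//|x]; first exact: cvg_cst.
  by rewrite ltr01 -[in O x](setCK O) cO0 setC0.
exists (fine \o edist_inf (~` O)); split=> [x|x|x] /=.
- have := @edist_inf_continuous R X (~` O) x.
  rewrite /continuous_at -(fineK (edist_inf_fin_num x nO)).
  exact: fine_cvg.
- by rewrite fine_ge0 ?edist_inf_ge0.
- rewrite -lte_fin (fineK (edist_inf_fin_num x nO)).
  split=> [+|Ox]; first by apply: contraPP => nOx; rewrite edist_inf0// ltxx.
  have /nbhs_ballP[e/= e0 eO] := open_nbhs_nbhs (conj oO Ox).
  apply: (@lt_le_trans _ _ e%:E); first by rewrite lte_fin.
  apply: le_ereal_inf_tmp => _ /= [y nOy <-]; rewrite leNgt; apply/negP.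
  by move=> /(@edist_lt_ball _ _ _ (x, y)) /eO.
Qed.
End separation.

Section vague_borel.
Context {R : realType} (X : polishType R).
Local Notation PM := (pointMeasure X).

Lemma vague_test_measurable (g : vague_test X) :
  measurable_fun setT (fun mu : PM => (\int[mu]_x g x)%R).
Proof.
apply: continuous_borel_measurable; apply/continuousP => A oA.
pose ev (f : prod_topology (fun _ : vague_test X => R)) : R := f g.
have oA1 : open (ev @^-1` A).
  (* [{classic _}] provides the decidable equality on indices that coordinate
     projections of a product space ask for. *)
  apply: open_comp oA => f _.
  exact: (@proj_continuous {classic (vague_test X)} (fun=> R) g f).
have oA2 : open (@vague_eval R X @^-1` (ev @^-1` A)) by exists (ev @^-1` A).
by exists (@vague_eval R X @^-1` (ev @^-1` A)).
Qed.

Lemma bounded_borel_sub (C D : set (borel X)) : measurable C -> C `<=` D ->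
  bounded_borel D -> bounded_borel C.
Proof.
move=> mC CD [_ [x [r Dr]]]; split=> //; exists x, r.
exact: subset_trans Dr.
Qed.

Lemma metric_bounded_open (B : set X) : metric_bounded B ->
  exists O : set X, [/\ open O, metric_bounded O & B `<=` O].
Proof.
move=> [x [r Br]]; exists (ball x (r + 1))^°; split.
- exact: open_interior.
- by exists x, (r + 1); exact: interior_subset.
- move=> y /Br xry; apply/nbhs_ballP; exists 1 => //= z.
  exact: ball_triangle.
Qed.

(** The functions [min(n phi, 1)], with [phi] positive exactly on [O], are
    admissible vague test functions increasing to the indicator of [O]. *)
Lemma measurable_eval_open (O : set X) : open O -> metric_bounded O ->
  measurable_fun setT (fun mu : PM => mu O).
Proof.
move=> oO bO; have [phi [cphi phi0 phiO]] := open_positivity_set oO.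
have mO : measurable (O : set (borel X)) by exact: sub_sigma_algebra.
have phiN x : ~ O x -> phi x = 0.
  by move=> nOx; apply/eqP; rewrite eq_le phi0 andbT leNgt; apply/negP => /phiO.
pose g (n : nat) (x : X) : R := Num.min (n%:R * phi x) 1.
have cg n : continuous (g n).
  move=> x; apply: (@continuous_min R X (fun x => n%:R * phi x) (cst 1)).
    by apply: cvgM; [exact: cvg_cst|exact: cphi].
  exact: cvg_cst.
have g01 n x : 0 <= g n x <= 1.
  by rewrite /g le_min ler01 ge_min lexx orbT !andbT mulr_ge0.
have gN n x : ~ O x -> g n x = 0.
  by move=> nOx; rewrite /g phiN// mulr0 min_l.
have bg n : exists M, forall x, `|g n x| <= M.
  by exists 1 => x; have /andP[g0 g1] := g01 n x; rewrite ger0_norm.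
have sg n : metric_bounded [set x | g n x != 0].
  case: bO => x [r Or]; exists x, r; apply: subset_trans Or => y /=.
  by apply: contra_neqP => /gN ->.
pose t n := VagueTest (cg n) (bg n) (sg n).
have mg n : measurable_fun setT (EFin \o g n : borel X -> \bar R).
  by apply/measurable_EFinP; exact: continuous_borel_measurable.
apply: (@emeasurable_fun_cvg _ _ _ _
  (fun n (mu : PM) => (\int[mu]_x t n x)%R%:E)).
  by move=> n; apply/measurable_EFinP; exact: vague_test_measurable.
move=> mu _.
have -> : (fun n => (\int[mu]_x t n x)%R%:E) =
          (fun n => \int[mu]_x (g n x)%:E)%E.
  apply/funext => n; rewrite /Rintegral fineK// ge0_fin_numE; last first.
    by apply: integral_ge0 => x _; rewrite lee_fin; case/andP: (g01 n x).
  apply: (@le_lt_trans _ _ (\int[mu]_x (\1_O x)%:E)%E); last first.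
    by rewrite integral_indic// setIT; apply: lf_finite.
  apply: ge0_le_integral => //.
  - by move=> x _; rewrite lee_fin; case/andP: (g01 n x).
  - exact: mg.
  - by apply/measurable_EFinP; exact: (@measurable_indic _ (borel X)).
  - move=> x _; rewrite lee_fin indicE /t /=; have [Ox|nOx] := pselect (O x).
      by rewrite mem_set//; case/andP: (g01 n x).
    by rewrite gN.
have -> : mu O = (\int[mu]_x limn (fun n => (g n x)%:E))%E.
  rewrite -[in LHS](setIT O) -integral_indic//; apply: eq_integral => x _.
  apply/esym/cvg_lim => //; apply: cvg_EFin; first by near=> n.
  rewrite indicE; have [Ox|nOx] := pselect (O x).
    rewrite mem_set//; apply: cvg_near_cst; near=> n.
    rewrite /= /g min_r// -ler_pdivrMr ?phiO//; near: n.
    exact: nbhs_infty_ger.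
  by rewrite memNset//; apply: cvg_near_cst; near=> n; exact: gN.
apply: cvg_monotone_convergence => //.
- by move=> n x _; rewrite lee_fin; case/andP: (g01 n x).
- move=> x _ m n mn; rewrite lee_fin /g; apply: le_min2 => //.
  by rewrite ler_wpM2r// ler_nat.
Unshelve. all: by end_near. Qed.

(** Dynkin's theorem applied to the sets [S] such that [mu (S `&` W)] is
    measurable in [mu], for a bounded open [W] containing [C]: cutting by [W]
    keeps all masses finite, so that complements cause no [+oo - +oo]. *)
Lemma measurable_eval (C : set (borel X)) : bounded_borel C ->
  measurable_fun setT (fun mu : PM => mu C).
Proof.
move=> [mC /metric_bounded_open[W [oW bW CW]]].
have mW : measurable (W : set (borel X)) by exact: sub_sigma_algebra.
have bbW : bounded_borel (W : set (borel X)) by [].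
rewrite -(setIidl CW).
pose Q (S : set (borel X)) := measurable_fun setT (fun mu : PM => mu (S `&` W)).
suff : Q C by [].
apply: (@dynkin_induction _ (borel X) open Q) => //.
- by move=> U V oU oV; exact: openI.
- by rewrite /Q; under eq_fun do rewrite setTI; exact: measurable_eval_open.
- move=> U oU; apply: measurable_eval_open; first exact: openI.
  by case: bW => x [r Wr]; exists x, r => y [_ /Wr].
- move=> S mS QS; rewrite /Q.
  have -> : (fun mu : PM => mu (~` S `&` W)) =
            (fun mu => mu W - mu (S `&` W))%E.
    apply/funext => mu; rewrite setIC -setDE measureD//; last exact: lf_finite.
    by rewrite setIC.
  by apply: emeasurable_funB => //; exact: measurable_eval_open.
- move=> F mF tF QF; rewrite /Q.
  have -> : (fun mu : PM => mu (\bigcup_k F k `&` W)) =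
            (fun mu => \sum_(k <oo) mu (F k `&` W))%E.
    apply/funext => mu; rewrite setI_bigcupl measure_bigcup//.
    - by apply: eq_eseriesl => k; rewrite in_setT.
    - by move=> k _; exact: measurableI.
    under eq_fun do rewrite setIC; exact: trivIset_setIl.
  apply: ge0_emeasurable_sum => [k mu _ _|k _]; first exact: measure_ge0.
  exact: QF.
Qed.

Lemma measurable_fine_eval (C : set (borel X)) : bounded_borel C ->
  measurable_fun setT (fun mu : PM => fine (mu C)).
Proof. by move=> bC; apply: measurableT_comp => //; exact: measurable_eval. Qed.
End vague_borel.

(** * Atoms of point measures *)

Section atoms.
Context {R : realType} (X : polishType R).
Implicit Types (mu nu : pointMeasure X) (B : set X).

Lemma borel_set1 (x : X) : measurable ([set x] : set (borel X)).
Proof.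
rewrite -[[set x]]setCK; apply: measurableC; apply: sub_sigma_algebra.
apply: closed_openC; apply: accessible_closed_set1.
by apply: hausdorff_accessible; exact: metric_hausdorff.
Qed.

Lemma bounded_borel1 (x : X) : bounded_borel ([set x] : set (borel X)).
Proof.
split; first exact: borel_set1.
by exists x, 1 => _ ->; exact: ballxx.
Qed.

Lemma dense_sequence :
  exists d : nat -> X, forall e, 0 < e -> forall x, exists n, ball (d n) e x.
Proof.
have [D cD dD] := @separable R X.
have [D0|[d]] := pfcard_geP cD.
  have := dD setT (ex_intro _ point I) openT.
  by rewrite D0 setI0 => -[].
exists d => e e0 x.
have ne : (ball x e)^° !=set0 by exists x; apply/nbhs_ballP; exists e.
have [y [xy Dy]] := dD _ ne (@open_interior _ _).
have [n _ dn] := @surj _ _ _ _ d y Dy; exists n; rewrite dn; apply: ball_sym.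
exact: (interior_subset xy).
Qed.

Lemma ball_interior_double (x y : X) (e : R) : 0 < e -> ball x e y ->
  (ball x (e + e))^° y.
Proof.
by move=> e0 xy; apply/nbhs_ballP; exists e => //= z; exact: ball_triangle.
Qed.

(** Choose [E] in [C] with the least positive mass; every Borel set then meets
    [E] in a null set or in a set of full mass.  By separability, at each scale
    some small ball has full mass in [E], and so has the intersection of these
    balls over all scales, which contains at most one point. *)
Lemma atom_exists mu (C : set (borel X)) : bounded_borel C -> mu C != 0%E ->
  exists2 x : X, C x & mu [set x] != 0%E.
Proof.
move=> bC muC; have mC := bC.1.
pose P n := `[< exists E : set (borel X),
  [/\ measurable E, E `<=` C & mu E = n.+1%:R%:E] >].
have [[|n] nE] := pm_integer mu bC; first by rewrite nE eqxx in muC.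
have exP : exists n, P n.
  by exists n; apply/asboolP; exists C; split => //; exact: subset_refl.
case: (ex_minnP exP) => m /asboolP[E [mE EC muE]] mmin.
have bS (F : set (borel X)) : measurable F -> F `<=` E -> bounded_borel F.
  by move=> mF FE; apply: bounded_borel_sub bC => //; exact: subset_trans EC.
(* By minimality E cannot be split into two parts of positive mass. *)
have split0 (F : set (borel X)) : measurable F ->
    mu (E `&` F) != 0%E -> mu (E `\` F) = 0%E.
  move=> mF.
  have mI : measurable (E `&` F) by exact: measurableI.
  have mD : measurable (E `\` F) by exact: measurableD.
  have [k kE] := pm_integer mu (bS _ mI (@subIsetl _ _ _)).
  have [l lE] := pm_integer mu (bS _ mD (@subDsetl _ _ _)).
  have : mu E = (mu (E `\` F) + mu (E `&` F))%E by apply: measureDI.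
  rewrite muE kE lE -EFinD -natrD => -[/eqP]; rewrite eqr_nat => /eqP.
  case: k kE => [|k] kE; first by rewrite eqxx.
  case: l lE => [//|l] lE mkl _; have : (m <= l)%N.
    apply: mmin; apply/asboolP; exists (E `\` F); split => //.
    by apply: subset_trans EC; exact: subDsetl.
  by move: mkl; rewrite addSn addnS => -[->]; rewrite leqNgt ltnS leq_addr.
have negE : ~ mu.-negligible E.
  move=> /(negligibleP mu mE) E0; have := etrans (esym muE) E0.
  by move=> /eqP; rewrite eqe pnatr_eq0.
have [d dP] := dense_sequence.
pose e k : R := k.+1%:R^-1.
have e0 k : 0 < e k by rewrite invr_gt0.
pose b k i : set (borel X) := (ball (d i) (e k + e k))^°.
have mb k i : measurable (b k i).
  by apply: sub_sigma_algebra; exact: open_interior.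
have /choice[c cP] : forall k, exists i, mu (E `\` b k i) = 0%E.
  move=> k; apply: contrapT => /forallNP nk; apply: negE.
  have /negligibleS : E `<=` \bigcup_i (E `&` b k i).
    move=> x Ex; have [i xi] := dP _ (e0 k) x.
    by exists i => //; split => //; exact: ball_interior_double.
  apply; apply: negligible_bigcup => i.
  apply/negligibleP; first exact: measurableI.
  by apply/eqP; apply: contrapT => /negP /(split0 _ (mb k i)); exact: nk.
have negH : mu.-negligible (\bigcup_k (E `\` b k (c k))).
  apply: negligible_bigcup => k.
  by apply/negligibleP; [exact: measurableD|exact: cP].
(* [E] is not null, so it contains a point common to all chosen balls. *)
have [x [Ex xb]] : exists x : X, E x /\ forall k, b k (c k) x.
  apply: contrapT => nx; apply: negE.
  apply: (negligibleS _ negH) => x Ex; apply: contrapT => nHx; apply: nx.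
  exists x; split => // k.
  by apply: contrapT => nb; apply: nHx; exists k.
exists x; first exact: EC.
apply: contraPneq negE => x0 nE'; apply: nE'.
have /negligibleS : E `<=` [set x] `|` \bigcup_k (E `\` b k (c k)).
  move=> y Ey; have [->|yx] := eqVneq y x; [by left|right].
  apply: contrapT => nHy.
  have yb k : b k (c k) y by apply: contrapT => nb; apply: nHy; exists k.
  (* Two points common to all the balls would be at distance less than 4 e_k
     for every k. *)
  have : 0 < mdist x y by rewrite mdist_gt0 eq_sym.
  move=> xy0; have xy4 := divr_gt0 xy0 (ltr0n R 4).
  have [k _ kxy] := near_infty_natSinv_lt (PosNum xy4).
  have := kxy k (leqnn _) => /=; rewrite -/(e k) => ek.
  have xk := ball_sym (@interior_subset _ _ _ (xb k)).
  have /(ball_triangle xk) := @interior_subset _ _ _ (yb k).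
  by rewrite ballEmdist/= => xy; clear - ek xy; lra.
apply; apply: negligibleU => //; apply/negligibleP => //; exact: borel_set1.
Qed.

(** [s] lists atoms of [mu] in [B], [m] gives their masses, and nothing else is
    left in [B]; as the masses are positive, [s] lists all of them. *)
Definition atom_decomposition B mu (s : seq X) (m : X -> posnat) :=
  [/\ uniq s,
      forall x, x \in s -> B x /\ mu [set x] = (val (m x))%:R%:E
    & mu (B `\` [set` s]) = 0%E].

Lemma set_seq_cons (x : X) (s : seq X) :
  [set` x :: s] = [set x] `|` [set` s].
Proof.
apply/seteqP; split=> y /=; rewrite inE.
  by move=> /orP[/eqP|]; [left|right].
by move=> [->|ys]; rewrite ?eqxx// ys orbT.
Qed.

Lemma borel_seq (s : seq X) : measurable ([set` s] : set (borel X)).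
Proof.
elim: s => [|x s IH].
  by rewrite classical_sets.set_nil; exact: measurable0.
by rewrite set_seq_cons; apply: measurableU => //; exact: borel_set1.
Qed.

(** Induction on the mass of [B], removing one atom at a time. *)
Lemma atom_decomposition_exists B mu : bounded_borel B ->
  exists s m, atom_decomposition B mu s m.
Proof.
move=> bB; have [n] := pm_integer mu bB.
elim/ltn_ind: n B bB => n IH B bB nE.
have [B0|B0] := eqVneq (mu B) 0%E.
  exists [::], (cst posnat1); split => //.
  by rewrite classical_sets.set_nil setD0.
have [x Bx x0] := atom_exists bB B0.
have [[|j] jE] := pm_integer mu (bounded_borel1 x).
  by rewrite jE eqxx in x0.
have xB : [set x] `<=` B by move=> _ ->.
have mD : measurable (B `\` [set x] : set (borel X)).
  by apply: measurableD; [case: bB|exact: borel_set1].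
have bD : bounded_borel (B `\` [set x]).
  by apply: bounded_borel_sub bB => //; exact: subDsetl.
have [k kE] := pm_integer mu bD.
have kn : (k < n)%N.
  have : mu B = (mu (B `\` [set x]) + mu (B `&` [set x]))%E.
    by apply: measureDI; [case: bB|exact: borel_set1].
  rewrite (setIidr xB) nE kE jE -EFinD -natrD => -[/eqP].
  rewrite eqr_nat => /eqP ->.
  by rewrite addnS ltnS leq_addr.
have [s [m [us sm r0]]] := IH k kn _ bD kE.
have xs : x \notin s by apply/negP => /sm[[_ /(_ erefl)]].
exists (x :: s), (fun y => if y == x then exist _ j.+1 isT else m y); split.
- by rewrite /= xs.
- move=> y; rewrite inE; have [->|yx /= /sm[[]]] := eqVneq y x => //.
- by rewrite set_seq_cons -setDDl.
Qed.

End atoms.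

(** * Counting atoms by mass, and the effect of one additional point *)

Section counts_of_decompositions.
Context {R : realType} (X : polishType R).
Implicit Types (mu nu : pointMeasure X) (B : set (borel X)).
Implicit Types (s : seq X) (m : X -> posnat).

Lemma sites_decomposition B mu s m (j : posnat) : measurable B ->
  atom_decomposition B mu s m ->
  sites B mu j = [set` [seq x <- s | m x == j]].
Proof.
move=> mB [us sm r0]; apply/seteqP; split=> x /=; rewrite mem_filter.
  move=> [Bx]; rewrite -[mu _]/(mu ([set x] : set (borel X))) => xj.
  have [xs|xs] := boolP (x \in s); last first.
    have : (mu [set x] <= mu (B `\` [set` s]))%E.
      apply: le_measure; rewrite ?inE; [exact: borel_set1| |].
        by apply: measurableD => //; exact: borel_seq.
      by move=> _ ->; split => //; apply/negP.
    by rewrite r0 xj lee_fin lern0 eqn0Ngt (valP j).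
  rewrite andbT; have [_ xm] := sm x xs.
  by have [/eqP] := etrans (esym xm) xj; rewrite eqr_nat.
by move=> /andP[/eqP mj xs]; have [Bx xm] := sm x xs; rewrite -mj.
Qed.

Lemma counts_decomposition B mu s m (j : posnat) : measurable B ->
  atom_decomposition B mu s m ->
  counts B mu j = count (fun x => m x == j) s.
Proof.
move=> mB dec; have sE k := sites_decomposition k mB dec.
have fin : finite_set [set j | sites B mu j !=set0].
  apply: (@sub_finite_set _ _ [set` map m s]); last exact: finite_seq.
  move=> k; rewrite /= sE => -[x /=]; rewrite mem_filter => /andP[/eqP <- xs].
  exact: map_f.
have us : uniq s by case: dec.
have cE : #|` fset_set (sites B mu j)| = count (fun x => m x == j) s.
  rewrite sE (_ : [set` _] = [set` [fset x in [seq x <- s | m x == j]]%fset]).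
    by rewrite set_fsetK card_fseq undup_id ?filter_uniq// size_filter.
  by apply/seteqP; split=> x /=; rewrite !inE.
rewrite /counts fsfunE; case: ifPn; rewrite in_fset_set// notin_setE => nj.
rewrite -cE; have [-> |/set0P//] := eqVneq (sites B mu j) set0.
by rewrite fset_set0.
Qed.

Lemma pm_addE mu nu (C : set (borel X)) : pm_add mu nu C = (mu C + nu C)%E.
Proof. exact: (measure_addE mu nu C). Qed.

Lemma le_pm mu (C D : set (borel X)) : measurable C -> measurable D ->
  C `<=` D -> (mu C <= mu D)%E.
Proof. by move=> mC mD; apply: le_measure; rewrite inE. Qed.

Lemma pm_sub0 mu (C D : set (borel X)) : measurable C -> measurable D ->
  C `<=` D -> mu D = 0%E -> mu C = 0%E.
Proof.
by move=> mC mD CD D0; apply/eqP; rewrite eq_le measure_ge0 andbT -D0 le_pm.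
Qed.

Lemma counts_add_null B mu nu : bounded_borel B -> mu B = 0%E ->
  counts B (pm_add mu nu) = counts B nu.
Proof.
move=> bB B0; have mB := bB.1.
have [s [m dec]] := atom_decomposition_exists nu bB.
have ms := borel_seq s; have [us sm r0] := dec.
apply/msetP => j; rewrite (counts_decomposition j mB dec).
apply: counts_decomposition => //; split => // [x xs|].
  have [Bx xm] := sm x xs; rewrite pm_addE xm (pm_sub0 _ mB _ B0) ?add0e//.
    exact: borel_set1.
  by move=> _ ->.
rewrite pm_addE [X in (_ + X)%E]r0 adde0; apply: (pm_sub0 _ mB _ B0).
  exact: measurableD.
exact: subDsetl.
Qed.

Lemma null_off_atom B mu (a : X) : measurable B -> mu B = 1%E ->
  mu [set a] = 1%E -> B a -> mu (B `\` [set a]) = 0%E.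
Proof.
move=> mB B1 a1 Ba; have ma := borel_set1 a.
have aB : ([set a] : set (borel X)) `<=` B by move=> _ ->.
have : mu B = (mu (B `\` [set a]) + mu (B `&` [set a]))%E.
  exact: measureDI.
rewrite (setIidr aB) B1 a1; case: (mu (B `\` [set a])) => [r| |]//.
by rewrite -EFinD => -[/eqP]; rewrite -subr_eq subrr => /eqP <-.
Qed.

(** As [mu B = 1], the whole mass of [mu] in [B] sits at [a]; the atom [a] of
    [nu] becomes heavier, or a new atom of mass 1 appears. *)
Lemma add_atom_decomposition B mu nu s m (a : X) :
  bounded_borel B -> atom_decomposition B nu s m ->
  mu B = 1%E -> mu [set a] = 1%E -> B a ->
  atom_decomposition B (pm_add mu nu)
    (if a \in s then s else a :: s)
    (fun x => if x == a then if a \in s then posnat_succ (m a) else posnat1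
              else m x).
Proof.
move=> bB [us sm r0] B1 a1 Ba; have mB := bB.1.
have ms := borel_seq s; have ma := borel_set1 a.
have mBa : measurable (B `\` [set a]) by exact: measurableD.
have mBs : measurable (B `\` [set` s]) by exact: measurableD.
have Ba0 := null_off_atom mB B1 a1 Ba.
have mu0 x : B x -> x != a -> mu [set x] = 0%E.
  move=> Bx xa; apply: pm_sub0 mBa _ Ba0; first exact: borel_set1.
  by move=> _ ->; split => //; exact/eqP.
have nua : a \notin s -> nu [set a] = 0%E.
  move=> nas; apply: pm_sub0 mBs _ r0; first exact: borel_set1.
  by move=> _ ->; split => //; apply/negP.
have [as_|nas] := boolP (a \in s); split => //.
- move=> x xs; have [Bx xm] := sm x xs; split => //; rewrite pm_addE xm.
  have [xa|xa] := eqVneq x a; last by rewrite mu0// add0e.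
  by rewrite xa a1 -EFinD -natr1 addrC.
- rewrite pm_addE [X in (_ + X)%E]r0 adde0; apply: pm_sub0 mBa _ Ba0 => //.
  by move=> x [Bx xs]; split=> // xa; apply: xs; rewrite /= xa.
- by rewrite /= nas.
- move=> x; rewrite inE pm_addE; have [->|xa /= xs] := eqVneq x a.
    by rewrite a1 nua// adde0.
  by have [Bx ->] := sm x xs; rewrite mu0// add0e.
- have mas : measurable (B `\` [set` a :: s]).
    by apply: measurableD => //; exact: borel_seq.
  rewrite pm_addE set_seq_cons in mas *.
  rewrite (pm_sub0 mas mBa _ Ba0) ?(pm_sub0 mas mBs _ r0) ?adde0//.
    by move=> x [Bx nx]; split => // xs; apply: nx; right.
  by move=> x [Bx nx]; split => // xs; apply: nx; left.
Qed.

Lemma count_update s m (a : X) (k j : posnat) : uniq s -> a \in s ->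
  count (fun x => (if x == a then k else m x) == j) s =
  (count (fun x => m x == j) s - (j == m a) + (j == k))%N.
Proof.
move=> us as_; have /permP cnt := perm_to_rem as_.
rewrite !cnt /= eqxx (eq_sym j) (eq_sym j).
rewrite [((m a == j) + _)%N]addnC addnK addnC.
congr (_ + _)%N; apply: eq_in_count => x; rewrite mem_rem_uniq// inE.
by case/andP => /negbTE ->.
Qed.

Lemma counts_add_old B mu nu s m (a : X) :
  bounded_borel B -> atom_decomposition B nu s m ->
  mu B = 1%E -> mu [set a] = 1%E -> a \in s ->
  counts B (pm_add mu nu) =
  ((counts B nu `\ m a) `+` [mset posnat_succ (m a)])%mset.
Proof.
move=> bB dec B1 a1 as_; have [us sm _] := dec; have [Ba _] := sm a as_.
have := add_atom_decomposition bB dec B1 a1 Ba; rewrite as_ => dec'.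
apply/msetP => j; rewrite (counts_decomposition j bB.1 dec') count_update//.
by rewrite msetE2 msetB1E msetnE (counts_decomposition j bB.1 dec).
Qed.

Lemma counts_add_new B mu nu s m (a : X) :
  bounded_borel B -> atom_decomposition B nu s m ->
  mu B = 1%E -> mu [set a] = 1%E -> B a -> a \notin s ->
  counts B (pm_add mu nu) = (counts B nu `+` [mset posnat1])%mset.
Proof.
move=> bB dec B1 a1 Ba nas.
have := add_atom_decomposition bB dec B1 a1 Ba; rewrite (negbTE nas) => dec'.
apply/msetP => j; rewrite (counts_decomposition j bB.1 dec') /= eqxx addnC.
rewrite msetE2 msetnE (counts_decomposition j bB.1 dec) (eq_sym j).
congr (_ + _)%N; apply: eq_in_count => x xs.
by have [xa|//] := eqVneq x a; rewrite -xa xs in nas.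
Qed.

(** Summing over the atoms and grouping them by mass: this is where the factor
    [eta(j)] of the generator comes from. *)
Lemma sum_counts B nu s m (G : posnat -> R) : measurable B ->
  atom_decomposition B nu s m ->
  \sum_(j <- finsupp (counts B nu)) (counts B nu j)%:R * G j =
  \sum_(x <- s) G (m x).
Proof.
move=> mB dec; have cE j := counts_decomposition j mB dec.
have supp x : x \in s -> m x \in finsupp (counts B nu).
  move=> xs; rewrite mem_finsupp cE -lt0n -has_count; apply/hasP.
  by exists x.
transitivity (\sum_(x <- s) \sum_(j <- finsupp (counts B nu))
    (m x == j)%:R * G j); last first.
  rewrite big_seq [RHS]big_seq; apply: eq_bigr => x xs.
  rewrite (big_fsetD1 (m x)) ?supp//= eqxx mul1r big1_fset ?addr0// => j.
  by rewrite !inE eq_sym => /andP[/negbTE -> _ _]; rewrite mul0r.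
rewrite exchange_big/=; apply: eq_bigr => j _.
by rewrite -big_distrl/= -natr_sum cE -sum1_count big_mkcond.
Qed.

End counts_of_decompositions.

(** * Perturbation of integrals *)

Section lower_integral.
Local Open Scope ereal_scope.
Context d (T : measurableType d) (R : realType).
Variable mu : {measure set T -> \bar R}.

Import HBNNSimple.

(** The integral of a nonnegative function is the supremum of the integrals of
    the simple functions below it, hence is monotone on all functions. *)
Lemma ge0_le_integral_lower (f g : T -> \bar R) : (forall x, 0 <= f x) ->
  (forall x, f x <= g x) -> \int[mu]_x f x <= \int[mu]_x g x.
Proof.
move=> f0 fg; have g0 x : 0 <= g x := le_trans (f0 x) (fg x).
rewrite !ge0_integralTE//; apply: ereal_sup_le => _ [h /= hf <-].
by exists h => //= x; exact: le_trans (fg x).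
Qed.

End lower_integral.

Section approximate_integral.
Context d (T : measurableType d) (R : realType) (Q : probability T R).

(** [f] is an arbitrary function that is only controlled by [g] up to an error
    supported in [D]. *)
Lemma ge0_integral_sandwich (f g : T -> R) (D : set T) (M : R) :
  measurable D -> measurable_fun setT g -> (forall x, 0 <= g x <= M) ->
  (forall x, g x <= f x <= g x + M * \1_D x) ->
  (\int[Q]_x (f x)%:E)%E \is a fin_num /\
  \int[Q]_x g x <= \int[Q]_x f x <= \int[Q]_x g x + M * fine (Q D).
Proof.
move=> mD mg gM gf.
have g0 x : 0 <= g x by case/andP: (gM x).
have M0 : 0 <= M by have /andP[] := gM point; exact: le_trans.
have mEg : measurable_fun setT (EFin \o g) by exact/measurable_EFinP.
have QD : Q D \is a fin_num by exact: fin_num_measure.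
have gfin : (\int[Q]_x (g x)%:E)%E \is a fin_num.
  rewrite ge0_fin_numE; last by apply: integral_ge0 => x _; rewrite lee_fin.
  apply: (@le_lt_trans _ _ (\int[Q]_x M%:E)%E); last first.
    by rewrite integral_cst// ltey_eq fin_numM// fin_num_measure.
  apply: ge0_le_integral_lower => x; rewrite lee_fin//.
  by case/andP: (gM x).
have lo : (\int[Q]_x (g x)%:E <= \int[Q]_x (f x)%:E)%E.
  apply: ge0_le_integral_lower => x; rewrite lee_fin//.
  by case/andP: (gf x).
have hi : (\int[Q]_x (f x)%:E <= \int[Q]_x (g x)%:E + M%:E * Q D)%E.
  apply: (@le_trans _ _ (\int[Q]_x ((g x)%:E + M%:E * (\1_D x)%:E))%E).
    apply: ge0_le_integral_lower => x; rewrite -?EFinM -?EFinD lee_fin.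
      by case/andP: (gf x) => + _; exact: le_trans.
    by case/andP: (gf x).
  have mi : measurable_fun setT (fun x => (\1_D x)%:E : \bar R).
    by apply/measurable_EFinP; exact: measurable_indic.
  rewrite ge0_integralD//=.
  - by rewrite ge0_integralZl// integral_indic// setIT.
  - by move=> x _; rewrite lee_fin.
  - by move=> x _; rewrite lee_fin mulr_ge0.
  - by apply: emeasurable_funM => //; exact: measurable_cst.
have ffin : (\int[Q]_x (f x)%:E)%E \is a fin_num.
  rewrite ge0_fin_numE; last first.
    by apply: le_trans lo; apply: integral_ge0 => x _; rewrite lee_fin.
  by apply: le_lt_trans hi _; rewrite -(fineK gfin) -(fineK QD) ltry.
split=> //; rewrite /Rintegral -!lee_fin EFinD EFinM !fineK//.
by rewrite lo hi.
Qed.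

(** [F] is unconstrained on [D] apart from the bound [M].  This is applied with
    [D] the event of at least two added points, off which [F] takes finitely
    many values; so only [D] and those finitely many level sets, rather than the
    map [mu |-> counts B mu], have to be measurable.
    The positive and negative parts of [F] are compared separately, since only
    for nonnegative functions is the integral monotone in this generality. *)
Lemma Rintegral_perturbation (F G : T -> R) (D : set T) (M : R) :
  measurable D -> measurable_fun setT G -> (forall x, `|F x| <= M) ->
  (forall x, ~ D x -> G x = F x) -> (forall x, D x -> G x = 0) ->
  `| \int[Q]_x F x - \int[Q]_x G x | <= M * fine (Q D).
Proof.
move=> mD mG FM GF G0.
have M0 : 0 <= M by exact: le_trans (normr_ge0 _) (FM point).
have bound (H : R -> R) : (forall r, 0 <= H r <= `|r|) -> H 0 = 0 ->
    forall x, (0 <= H (G x) <= M) /\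
      (H (G x) <= H (F x) <= H (G x) + M * \1_D x).
  move=> Hr H0 x; have /andP[h0 h1] := Hr (F x).
  have hM := le_trans h1 (FM x); rewrite indicE.
  have [Dx|nDx] := pselect (D x).
    by rewrite G0// H0 add0r mem_set// mulr1 lexx M0 h0.
  by rewrite GF// memNset// mulr0 addr0 h0 hM lexx.
have posr (r : R) : 0 <= Num.max r 0 <= `|r|.
  by rewrite le_max lexx orbT ge_max ler_norm normr_ge0.
have negr (r : R) : 0 <= Num.max (- r) 0 <= `|r|.
  by rewrite -normrN posr.
have bp := bound (fun r => Num.max r 0) posr (maxxx _).
have neg0 : Num.max (- 0) 0 = 0 :> R by rewrite oppr0 maxxx.
have bn := bound (fun r => Num.max (- r) 0) negr neg0.
have mGp : measurable_fun setT G^\+ by exact: measurable_funrpos.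
have mGn : measurable_fun setT G^\- by exact: measurable_funrneg.
have [fFp /andP[lp hp]] := @ge0_integral_sandwich F^\+ G^\+ D M mD mGp
  (fun x => (bp x).1) (fun x => (bp x).2).
have [fFn /andP[ln hn]] := @ge0_integral_sandwich F^\- G^\- D M mD mGn
  (fun x => (bn x).1) (fun x => (bn x).2).
have Gle (H : T -> R) : measurable_fun setT H -> (forall x, 0 <= H x <= M) ->
    (\int[Q]_x (H x)%:E)%E \is a fin_num.
  move=> mH HM; apply: (ge0_integral_sandwich measurable0 mH HM _).1 => x.
  by rewrite indic0 mulr0 addr0 lexx.
have fGp := Gle _ mGp (fun x => (bp x).1).
have fGn := Gle _ mGn (fun x => (bn x).1).
have split (H : T -> R) : (\int[Q]_x (H^\+ x)%:E)%E \is a fin_num ->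
    (\int[Q]_x (H^\- x)%:E)%E \is a fin_num ->
    \int[Q]_x H x = \int[Q]_x H^\+ x - \int[Q]_x H^\- x.
  move=> Hp Hn; rewrite {1}/Rintegral integralE.
  by rewrite (funerpos H) (funerneg H) fineB.
rewrite (split F)// (split G)//.
move: lp hp ln hn; clear; move: (fine (Q D)) => q.
do 4! move: (Rintegral _ _ _) => ?.
by move=> *; rewrite ler_norml; apply/andP; split; lra.
Qed.

Lemma Rintegral_simple (I : Type) (r : seq I) (c : I -> R) (E : I -> set T) :
  (forall i, measurable (E i)) ->
  measurable_fun setT (fun x => \sum_(i <- r) c i * \1_(E i) x) /\
  \int[Q]_x (\sum_(i <- r) c i * \1_(E i) x) =
  \sum_(i <- r) c i * fine (Q (E i)).
Proof.
move=> mE.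
have int1 i : Q.-integrable setT (EFin \o (fun x => c i * \1_(E i) x)).
  rewrite (_ : _ \o _ = (fun x => (c i)%:E * (\1_(E i) x)%:E)%E)//.
  by apply: integrableZl => //; exact: integrable_indic.
suff [h e] : Q.-integrable setT
    (EFin \o (fun x => \sum_(i <- r) c i * \1_(E i) x)) /\
  \int[Q]_x (\sum_(i <- r) c i * \1_(E i) x) =
  \sum_(i <- r) c i * fine (Q (E i)).
  split => //; apply/measurable_EFinP; exact: measurable_int h.
elim: r => [|i r [IHi IH]].
  split.
    rewrite (_ : _ \o _ = cst 0%E); first exact: integrable0.
    by apply/funext => x /=; rewrite big_nil.
  under eq_Rintegral do rewrite big_nil.
  by rewrite big_nil Rintegral_cst// mul0r.
split.
  rewrite (_ : _ \o _ = ((EFin \o (fun x => (c i * \1_(E i) x)%R)) \+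
     (EFin \o (fun x => (\sum_(i <- r) c i * \1_(E i) x)%R)))%E).
    exact: integrableD.
  by apply/funext => x /=; rewrite big_cons EFinD.
under eq_Rintegral do rewrite big_cons.
rewrite RintegralD// IH big_cons; congr (_ + _).
rewrite RintegralZl//; last exact: integrable_indic.
by rewrite /Rintegral integral_indic// setIT.
Qed.

End approximate_integral.

(** * The number of points of a Polya sum process in a bounded set *)

Section polya_identities.
Context {R : realType} (X : polishType R).
Local Notation PM := (pointMeasure X).
Variables (z : R) (kappa : lfMeasure X) (Q : probability PM R).
Hypothesis z0 : 0 <= z.
Hypothesis hQ : is_polya_sum z kappa Q.
Variables (B : set (borel X)) (bB : bounded_borel B).
Implicit Types (mu : PM) (C : set (borel X)).

Let mB : measurable B := bB.1.

Lemma lf_fineK (nu : lfMeasure X) C : bounded_borel C ->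
  (fine (nu C))%:E = nu C.
Proof.
by move=> bC; rewrite fineK// ge0_fin_numE ?measure_ge0//; exact: lf_finite.
Qed.

Lemma integral_scaled_indic (nu : lfMeasure X) C (c : R) : measurable C ->
  0 <= c -> (\int[nu]_x (c * \1_C x)%:E = c%:E * nu C)%E.
Proof.
move=> mC c0; under eq_integral do rewrite EFinM.
rewrite ge0_integralZl//.
- by rewrite integral_indic// setIT.
- by apply/measurable_EFinP; exact: measurable_indic.
Qed.

(** The defining equation of the Polya sum process for [1_C(x) phi(mu B)]; the
    shift by 1 comes from the added point [x], which lies in [B]. *)
Lemma polya_count_identity (phi : R -> R) C :
  measurable_fun setT phi -> (forall r, 0 <= phi r) ->
  measurable C -> C `<=` B ->
  (\int[Q]_mu ((phi (fine (mu B)))%:E * mu C) =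
   \int[Q]_mu (z%:E * ((phi (fine (mu B) + 1))%:E * (kappa C + mu C))))%E.
Proof.
move=> mphi phi0 mC CB.
pose h (u : borel X * PM) : \bar R := (phi (fine (u.2 B)) * \1_C u.1)%:E.
have mh : measurable_fun setT h.
  apply/measurable_EFinP; apply: measurable_funM.
    apply: (measurableT_comp mphi).
    apply: (measurableT_comp (measurable_fine_eval bB)).
    exact: measurable_snd.
  by apply: measurableT_comp; [exact: measurable_indic|exact: measurable_fst].
have h0 u : (0 <= h u)%E by rewrite lee_fin mulr_ge0.
have := hQ mh h0; rewrite /h /=.
under eq_integral do rewrite integral_scaled_indic//.
move=> ->; apply: eq_integral => mu _; congr (_ * _)%E.
have -> : (kappa C + mu C)%E = lf_add kappa mu C.
  by rewrite -(measure_addE kappa mu C).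
rewrite -integral_scaled_indic//.
apply: eq_integral => x _; rewrite indicE.
have [Cx|nCx] := boolP (x \in C); last by rewrite !mulr0.
rewrite !mulr1; have Bx : B x by apply: CB; rewrite inE in Cx.
suff <- : fine (pm_add mu (pm_dirac x) B) = fine (mu B) + 1 by [].
by rewrite pm_addE /= diracE mem_set// -[in LHS]lf_fineK.
Qed.

Lemma measurable_atleast n C : bounded_borel C ->
  measurable [set mu : PM | (n%:R%:E <= mu C)%E].
Proof.
move=> bC; rewrite -[X in measurable X]setTI.
by apply: emeasurable_fun_c_infty => //; exact: measurable_eval.
Qed.

Lemma measurable_eval_eq n C : bounded_borel C ->
  measurable [set mu : PM | mu C = n%:R%:E].
Proof.
move=> bC; rewrite -[X in measurable X]setTI.
rewrite (_ : [set mu : PM | _] = (fun mu : PM => mu C) @^-1` [set n%:R%:E])//.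
exact: measurable_eval.
Qed.

(** The case [phi = 1_{1}]: if [mu B = 1] then [mu C] is 0 or 1, and if
    [mu B + 1 = 1] then [mu C = 0]. *)
Lemma polya_one_point C : measurable C -> C `<=` B ->
  Q [set mu : PM | mu B = 1%E /\ mu C = 1%E] =
  (z%:E * (kappa C * Q [set mu : PM | mu B = 0%E]))%E.
Proof.
move=> mC CB; have bC := bounded_borel_sub mC CB bB.
have mphi : measurable_fun setT (\1_[set (1 : R)] : R -> R).
  exact: measurable_indic.
have := polya_count_identity mphi (fun=> ler0n _ _) mC CB.
have m1 : measurable [set mu : PM | mu B = 1%E /\ mu C = 1%E].
  apply: (@measurableI _ PM [set mu : PM | mu B = 1%E]).
    exact: (measurable_eval_eq 1 bB).
  exact: (measurable_eval_eq 1 bC).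
have m0 : measurable [set mu : PM | mu B = 0%E].
  exact: (measurable_eval_eq 0 bB).
set E := [set mu | _]; set E0 := [set mu : PM | mu B = 0%E].
have lhs mu : ((\1_[set 1%R] (fine (mu B)))%:E * mu C = (\1_E mu)%:E)%E.
  have [n nB] := pm_integer mu bB; have [k kC] := pm_integer mu bC.
  have := le_pm mu mC mB CB; rewrite nB kC lee_fin ler_nat => kn.
  rewrite /= -EFinM !indicE /E /=; congr (_%:E).
  have [n1|n1] := eqVneq n 1%N; last first.
    rewrite !memNset ?mul0r//=.
      by rewrite nB => -[[/eqP]]; rewrite pnatr_eq1 (negbTE n1).
    by move=> /eqP; rewrite pnatr_eq1 (negbTE n1).
  rewrite n1 in nB kn *; rewrite mem_set ?mul1r//.
  move: kn; rewrite leq_eqVlt ltnS leqn0 => /orP[].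
    by move=> /eqP k1; rewrite mem_set/= ?k1//; split; rewrite ?nB ?kC ?k1.
  move=> /eqP k0; rewrite k0 memNset//= => -[_ /eqP].
  by rewrite kC k0 eqe eq_sym oner_eq0.
have rhs mu : ((\1_[set 1%R] (fine (mu B) + 1))%:E * (kappa C + mu C) =
    (fine (kappa C) * \1_E0 mu)%:E)%E.
  have [n nB] := pm_integer mu bB; have [k kC] := pm_integer mu bC.
  have := le_pm mu mC mB CB; rewrite nB kC lee_fin ler_nat => kn.
  rewrite -(lf_fineK kappa bC) -EFinD -EFinM !indicE /E0 /=; congr (_%:E).
  case: n nB kn => [|n] nB; last first.
    have n0 : ~ [set mu : PM | mu B = 0%E] mu.
      by rewrite /= nB => /eqP; rewrite eqe pnatr_eq0.
    have n1 : ~ [set (1 : R)] (n.+1%:R + 1).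
      by move=> /= /eqP; rewrite -subr_eq0 addrK pnatr_eq0.
    by rewrite (memNset n1) (memNset n0) mul0r mulr0.
  by rewrite leqn0 => /eqP ->; rewrite addr0 add0r mulrC !mem_set.
under eq_integral do rewrite lhs.
under [in RHS]eq_integral do rewrite rhs -EFinM mulrA.
rewrite integral_indic// setIT => ->.
rewrite -[in RHS](lf_fineK kappa bC) muleA -EFinM.
have zk0 : 0 <= z * fine (kappa C) by rewrite mulr_ge0// fine_ge0.
under eq_integral do rewrite EFinM.
rewrite ge0_integralZl//.
- by rewrite integral_indic// setIT.
- by apply/measurable_EFinP; exact: measurable_indic.
Qed.

(** The case [phi(r) = 1_{r >= n + 1} / r]: dividing by the number of points
    turns expectations, which might be infinite, into probabilities; on the
    right the integrand is [(kappa B + N) / (N + 1) <= kappa B + 1] where it is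
    not zero. *)
Lemma polya_atleast n :
  (Q [set mu : PM | (n.+1%:R%:E <= mu B)%E] <=
   z%:E * ((kappa B + 1) * Q [set mu : PM | (n%:R%:E <= mu B)%E]))%E.
Proof.
pose ge k : set R := [set r | k%:R <= r].
have mge k : measurable (ge k).
  by rewrite /ge -set_itvcy; exact: measurable_itv.
pose phi (r : R) := r `^ (-1) * \1_(ge n.+1) r.
have mphi : measurable_fun setT phi.
  by apply: measurable_funM; [exact: measurable_powR|exact: measurable_indic].
have phi0 r : 0 <= phi r by rewrite mulr_ge0 ?powR_ge0.
set E := [set mu | _]; set E0 := [set mu : PM | (n%:R%:E <= mu B)%E].
have mE : measurable E by exact: measurable_atleast.
have mE0 : measurable E0 by exact: measurable_atleast.
have lhs mu : ((phi (fine (mu B)))%:E * mu B = (\1_E mu)%:E)%E.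
  have [k kB] := pm_integer mu bB; rewrite kB -EFinM; congr (_%:E).
  rewrite /phi /= !indicE /E /ge /=; have [nk|nk] := leqP n.+1 k.
    rewrite !mem_set/= ?kB ?lee_fin ?ler_nat// mulr1 powR_inv1// mulVf//.
    by rewrite pnatr_eq0 -lt0n; apply: leq_trans nk.
  by rewrite !memNset/= ?mulr0 ?mul0r// ?kB ?lee_fin ler_nat; apply/negP;
    rewrite -ltnNge.
have c0 : 0 <= z * (fine (kappa B) + 1).
  by rewrite mulr_ge0// addr_ge0// fine_ge0.
have := polya_count_identity mphi phi0 mB (@subset_refl _ B).
under eq_integral do rewrite lhs.
rewrite integral_indic// setIT => ->.
apply: (@le_trans _ _ (\int[Q]_mu
    ((z * (fine (kappa B) + 1))%:E * (\1_E0 mu)%:E))%E); last first.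
  rewrite ge0_integralZl//.
    by rewrite integral_indic// setIT EFinM -muleA EFinD lf_fineK.
  by apply/measurable_EFinP; exact: measurable_indic.
apply: ge0_le_integral_lower => mu.
  by rewrite mule_ge0 ?lee_fin// mule_ge0 ?lee_fin// adde_ge0.
have [k kB] := pm_integer mu bB.
rewrite -[in leLHS](lf_fineK kappa bB) kB -EFinD -!EFinM lee_fin -!mulrA.
rewrite ler_wpM2l// /phi !indicE /= natr1.
have [nk|nk] := leqP n k; last first.
  have n0 : ~ E0 mu by rewrite /E0/= kB lee_fin ler_nat leqNgt nk.
  have n1 : ~ ge n.+1 k.+1%:R by rewrite /ge/= ler_nat ltnS leqNgt nk.
  by rewrite (memNset n0) (memNset n1) mulr0 mul0r mulr0.
have e0 : E0 mu by rewrite /E0/= kB lee_fin ler_nat.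
have e1 : ge n.+1 k.+1%:R by rewrite /ge/= ler_nat.
rewrite (mem_set e0) (mem_set e1) mul1r mulr1 powR_inv1//.
have k0 : 0 <= fine (kappa B) by rewrite fine_ge0.
rewrite ler_pdivrMl// -natr1 -subr_ge0.
rewrite (_ : _ - _ = k%:R * fine (kappa B) + 1); last by ring.
by rewrite addr_ge0// mulr_ge0.
Qed.

End polya_identities.

(** * First-order expansion of the transition kernel *)

Section expansion.
Context {R : realType} (X : polishType R).
Local Notation PM := (pointMeasure X).
Variables (B : set (borel X)) (bB : bounded_borel B).
Variables (nu : PM) (s : seq X) (m : X -> posnat).
Hypothesis dec : atom_decomposition B nu s m.
Implicit Types (mu : PM) (o : option X).

Let mB : measurable B := bB.1.
Let us : uniq s. Proof. by case: dec. Qed.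

(** The places where a single added point may fall: an atom [a] of [nu], encoded
    as [Some a], or the rest of [B], encoded as [None]. *)
Definition cell o : set (borel X) :=
  if o is Some a then [set a] else B `\` [set` s].

Definition cells : seq (option X) := None :: map Some s.

Definition one_point_in o : set PM :=
  [set mu | mu B = 1%E /\ mu (cell o) = 1%E].

Definition shifted_counts o : countMeasure :=
  if o is Some a
  then ((counts B nu `\ m a) `+` [mset posnat_succ (m a)])%mset
  else (counts B nu `+` [mset posnat1])%mset.

Lemma measurable_cell o : measurable (cell o).
Proof.
case: o => [a|]; first exact: borel_set1.
by apply: measurableD => //; exact: borel_seq.
Qed.

Lemma cell_sub o : o \in cells -> cell o `<=` B.
Proof.
rewrite inE => /orP[/eqP -> |/mapP[a as_ ->]]; first exact: subDsetl.
by have [_ /(_ _ as_)[Ba _] _] := dec; move=> _ ->.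
Qed.

Lemma uniq_cells : uniq cells.
Proof.
rewrite /= map_inj_uniq ?us ?andbT; last by move=> ? ? [].
by apply/negP => /mapP[].
Qed.

(** If one point is added, it falls in exactly one cell, and the cell determines
    the new counts. *)
Lemma one_point_cell mu : mu B = 1%E ->
  exists2 o, o \in cells &
    [/\ one_point_in o mu,
        forall o', o' \in cells -> o' != o -> ~ one_point_in o' mu
      & counts B (pm_add mu nu) = shifted_counts o].
Proof.
move=> B1.
have [a Ba a0] : exists2 a : X, B a & mu [set a] != 0%E.
  by apply: atom_exists => //; rewrite B1 eqe oner_eq0.
have ma := borel_set1 a.
have aB : ([set a] : set (borel X)) `<=` B by move=> _ ->.
have le1 C : measurable C -> C `<=` B -> (mu C <= 1)%E.
  by move=> mC CB; rewrite -B1 le_pm.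
have ge1 (C : set (borel X)) : measurable C -> C a -> (1 <= mu C)%E.
  move=> mC Ca; apply: (@le_trans _ _ (mu [set a])).
    have [[|n] nE] := pm_integer mu (bounded_borel1 a).
      by rewrite nE eqxx in a0.
    by rewrite nE lee_fin ler1n.
  by apply: le_pm => // _ ->.
have eq1 (C : set (borel X)) : measurable C -> C `<=` B -> C a -> mu C = 1%E.
  by move=> mC CB Ca; apply/eqP; rewrite eq_le le1// ge1.
have a1 : mu [set a] = 1%E by exact: eq1.
have mBa : measurable (B `\` [set a]) by exact: measurableD.
have Ba0 := null_off_atom mB B1 a1 Ba.
have far o' : o' \in cells -> ~ cell o' a -> ~ one_point_in o' mu.
  move=> o's nCa [_]; rewrite (pm_sub0 (measurable_cell o') mBa _ Ba0).
    by move=> /eqP; rewrite eqe eq_sym oner_eq0.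
  move=> x Cx; split; first exact: (cell_sub o's).
  by move=> xa; apply: nCa; rewrite -xa.
exists (if a \in s then Some a else None).
  case: ifPn => [as_|_]; last by rewrite inE.
  by rewrite inE; apply/orP; right; exact: map_f.
have [as_|nas] := boolP (a \in s); split.
- by split.
- move=> [b|] bs ab; apply: far => //=.
    by move=> ba; rewrite ba eqxx in ab.
  by move=> [_ /(_ as_)].
- exact: (counts_add_old bB dec B1 a1 as_).
- split => //; apply: eq1; [exact: (measurable_cell None)|exact: subDsetl|].
  by split => //; apply/negP.
- move=> [b|] bs// _; apply: far => //= ab.
  move: bs; rewrite inE => /orP[//|/mapP[c cs [bc]]].
  by rewrite ab bc cs in nas.
- exact: (counts_add_new bB dec B1 a1 Ba nas).
Qed.

Variables (rho : lfMeasure X) (rho_diffuse : diffuse rho).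

Lemma diffuse_seq (r : seq X) : rho [set` r] = 0%E.
Proof.
elim: r => [|x r IH]; first by rewrite classical_sets.set_nil measure0.
rewrite set_seq_cons; apply/eqP; rewrite eq_le measure_ge0 andbT.
apply: (@le_trans _ _ (rho [set x] + rho [set` r])%E).
  by apply: measureU2; [exact: borel_set1|exact: borel_seq].
by rewrite rho_diffuse IH adde0.
Qed.

(** The mass that [rho + nu] gives to a cell, see [cell_massE]. *)
Definition cell_mass o : R :=
  if o is Some a then (val (m a))%:R else fine (rho B).

(** Here diffuseness enters: [rho] ignores the atoms of [nu], while [nu] gives
    no mass to the remaining cell. *)
Lemma cell_massE o : o \in cells -> lf_add rho nu (cell o) = (cell_mass o)%:E.
Proof.
have [_ sm r0] := dec.
rewrite (_ : lf_add rho nu _ = rho (cell o) + nu (cell o))%E; last first.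
  exact: (measure_addE rho nu (cell o)).
rewrite inE => /orP[/eqP -> |/mapP[a as_ ->]] /=; last first.
  by rewrite rho_diffuse add0e; case: (sm a as_).
rewrite r0 adde0 lf_fineK//.
have ms := borel_seq s.
have -> : rho B = (rho (B `\` [set` s]) + rho (B `&` [set` s]))%E.
  exact: measureDI.
rewrite (_ : rho (B `&` _) = 0%E) ?adde0//.
apply/eqP; rewrite eq_le measure_ge0 andbT -(diffuse_seq s).
by apply: le_measure; rewrite ?inE//; exact: measurableI.
Qed.

Lemma cell_mass_ge0 o : 0 <= cell_mass o.
Proof. by case: o => //=; rewrite fine_ge0. Qed.

Variables (z : R) (Q : probability PM R).
Hypothesis z0 : 0 <= z.
Hypothesis hQ : is_polya_sum z (lf_add rho nu) Q.

Lemma measurable_one_point_in o : measurable (one_point_in o).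
Proof.
apply: (@measurableI _ PM [set mu : PM | mu B = 1%E]).
  exact: (measurable_eval_eq 1 bB).
apply: (measurable_eval_eq 1); case: o => [a|]; first exact: bounded_borel1.
by apply: bounded_borel_sub bB; [exact: (measurable_cell None)|exact: subDsetl].
Qed.

Let q0 := fine (Q [set mu : PM | mu B = 0%E]).
Let q2 := fine (Q [set mu : PM | (2%:R%:E <= mu B)%E]).
Let k := fine (lf_add rho nu B) + 1.

Let k0 : 0 <= k. Proof. by rewrite addr_ge0// fine_ge0. Qed.

Lemma one_point_probability o : o \in cells ->
  fine (Q (one_point_in o)) = z * cell_mass o * q0.
Proof.
move=> os.
rewrite (polya_one_point z0 hQ bB (measurable_cell o) (cell_sub os)).
rewrite cell_massE// -[X in (_ * (_ * X))%E]fineK ?fin_num_measure//.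
  by rewrite -!EFinM /= mulrA.
exact: (measurable_eval_eq 0 bB).
Qed.

Lemma fine_polya_atleast n :
  fine (Q [set mu : PM | (n.+1%:R%:E <= mu B)%E]) <=
  z * (k * fine (Q [set mu : PM | (n%:R%:E <= mu B)%E])).
Proof.
have mE i := measurable_atleast i bB.
rewrite -lee_fin !EFinM !fineK ?fin_num_measure//; try exact: mE.
apply: le_trans (polya_atleast z0 hQ bB n) _.
by rewrite /k EFinD (lf_fineK _ bB); exact: lexx.
Qed.

Lemma atleast_one_probability :
  fine (Q [set mu : PM | (1%:R%:E <= mu B)%E]) <= z * k.
Proof.
apply: le_trans (fine_polya_atleast 0) _.
rewrite ler_wpM2l// ler_piMr// -lee_fin fineK.
  by apply: probability_le1; exact: measurable_atleast.
by apply: fin_num_measure; exact: measurable_atleast.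
Qed.

Lemma atleast_two_probability : q2 <= z ^+ 2 * k ^+ 2.
Proof.
apply: le_trans (fine_polya_atleast 1) _.
rewrite (_ : z ^+ 2 * k ^+ 2 = z * (k * (z * k))); last by ring.
by rewrite !ler_wpM2l// atleast_one_probability.
Qed.

Lemma no_point_probability : 1 - z * k <= q0 <= 1.
Proof.
have m1 := measurable_atleast 1 bB.
have q0E : q0 = 1 - fine (Q [set mu : PM | (1%:R%:E <= mu B)%E]).
  rewrite /q0 (_ : [set mu : PM | mu B = 0%E] =
      ~` [set mu : PM | (1%:R%:E <= mu B)%E]).
    by rewrite probability_setC// fineB// fin_num_measure.
  apply/seteqP; split=> mu /=; have [n ->] := pm_integer mu bB.
    by move=> /eqP; rewrite eqe pnatr_eq0 => /eqP ->; rewrite lee_fin ler_nat.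
  by rewrite lee_fin ler_nat => /negP; rewrite -ltnNge ltnS leqn0 => /eqP ->.
rewrite q0E lerD2l lerN2 atleast_one_probability /=.
by rewrite lerBlDr lerDl fine_ge0.
Qed.

(** Off the event [mu B >= 2], the integrand is [f (counts B nu)] when
    [mu B = 0] and [f (shifted_counts o)] when the added point is in [o]. *)
Lemma polya_integral_approx (f : countMeasure -> R) (M : R) :
  (forall eta, `|f eta| <= M) ->
  `| \int[Q]_mu f (counts B (pm_add mu nu)) -
     (f (counts B nu) * q0 +
      \sum_(o <- cells) f (shifted_counts o) * (z * cell_mass o * q0)) |
  <= M * q2.
Proof.
move=> fM.
pose ev (i : option (option X)) : set PM :=
  if i is Some o then one_point_in o else [set mu | mu B = 0%E].
pose val i := f (if i is Some o then shifted_counts o else counts B nu).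
have mev i : measurable (ev i).
  case: i => [c|]; last exact: (measurable_eval_eq 0 bB).
  exact: measurable_one_point_in.
have [mG GE] := Rintegral_simple Q (None :: map Some cells) val mev.
rewrite big_cons big_map /= in GE.
rewrite [X in _ - X](_ : _ = \int[Q]_mu
    (\sum_(i <- None :: map Some cells) val i * \1_(ev i) mu)); last first.
  rewrite GE; congr (_ + _).
  by apply: eq_big_seq => o os; rewrite one_point_probability.
apply: Rintegral_perturbation => //; first exact: measurable_atleast.
  move=> mu mu2; cbv beta; rewrite big_cons big_map /val /ev.
  have [n nE] := pm_integer mu bB.
  have : (n < 2)%N.
    rewrite ltnNge; apply/negP => n2; apply: mu2.
    by rewrite /= nE lee_fin ler_nat.
  case: n nE => [|[|//]] nE _.
    rewrite [X in _ + X]big1 ?addr0 => [|o _]; last first.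
      rewrite indicE memNset ?mulr0// => -[/eqP].
      by rewrite nE eqe eq_sym oner_eq0.
    by rewrite indicE mem_set// mulr1 counts_add_null.
  have [c cs [ce cc ->]] := one_point_cell nE.
  have n0 : ~ [set mu : PM | mu B = 0%E] mu.
    by rewrite /= nE => /eqP; rewrite eqe oner_eq0.
  rewrite indicE (memNset n0) mulr0 add0r (bigD1_seq c) ?uniq_cells//=.
  rewrite indicE (mem_set ce) mulr1.
  rewrite big_seq_cond big1 ?addr0// => c' /andP[c's c'c].
  by rewrite indicE memNset ?mulr0//; exact: cc.
move=> mu mu2; cbv beta; rewrite big_cons big_map /val /ev.
have [n nE] := pm_integer mu bB; rewrite /= nE lee_fin ler_nat in mu2.
have n0 : ~ [set mu : PM | mu B = 0%E] mu.
  by rewrite /= nE => /eqP; rewrite eqe pnatr_eq0 => /eqP n0; rewrite n0 in mu2.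
rewrite indicE (memNset n0) mulr0 add0r big1// => o _.
rewrite indicE memNset ?mulr0// => -[/eqP].
by rewrite nE eqe pnatr_eq1 => /eqP n1; rewrite n1 in mu2.
Qed.

(** [1 - s] times the generator, as a sum over the cells. *)
Definition jump_sum (f : countMeasure -> R) : R :=
  \sum_(o <- cells) cell_mass o * (f (shifted_counts o) - f (counts B nu)).

(** The same approximation for the constant function 1 shows that the weights of
    [polya_integral_approx] add up to 1 up to [Q (mu B >= 2)]; this turns the
    values [f (shifted_counts o)] into increments, without computing the total
    mass of [rho + nu] on [B]. *)
Lemma polya_first_order (f : countMeasure -> R) (M : R) :
  (forall eta, `|f eta| <= M) ->
  `| \int[Q]_mu f (counts B (pm_add mu nu)) - f (counts B nu) -
     z * jump_sum f | <= z ^+ 2 * (k * `|jump_sum f| + 2 * M * k ^+ 2).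
Proof.
move=> fM.
have M0 : 0 <= M := le_trans (normr_ge0 _) (fM mset0).
have approx := polya_integral_approx fM.
have one : `| 1 - (q0 + \sum_(o <- cells) z * cell_mass o * q0) | <= q2.
  have := @polya_integral_approx (cst 1) 1 _.
  rewrite Rintegral_cst// [fine _](_ : _ = 1); last first.
    exact: (congr1 fine (probability_setT Q)).
  rewrite mulr1 mul1r.
  under eq_bigr do rewrite mul1r.
  by rewrite !mul1r; apply => eta /=; rewrite normr1.
set I := \int[Q]_mu _ in approx *.
set f0 := f (counts B nu) in approx *.
set V := \sum_(o <- cells) _ in approx.
set W := \sum_(o <- cells) _ in one.
have VW : V - f0 * W = z * q0 * jump_sum f.
  rewrite /V /W /jump_sum !mulr_sumr -sumrB; apply: eq_bigr => o _.
  by rewrite -/f0; ring.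
have /andP[q0lo q0hi] := no_point_probability.
rewrite (_ : I - f0 - z * jump_sum f = (I - (f0 * q0 + V)) -
  f0 * (1 - (q0 + W)) - z * (1 - q0) * jump_sum f); last first.
  by rewrite -[V](subrK (f0 * W)) VW; ring.
apply: le_trans (ler_normB _ _) _.
rewrite [leRHS]mulrDr [leRHS]addrC lerD//; last first.
  rewrite !normrM (ger0_norm z0) mulrA ler_wpM2r//.
  rewrite expr2 -!mulrA ler_wpM2l// ger0_norm ?subr_ge0//.
  by rewrite lerBlDl -lerBlDr.
apply: le_trans (ler_normB _ _) _.
rewrite (_ : _ * (_ * _ * _) = M * (z ^+ 2 * k ^+ 2) + M * (z ^+ 2 * k ^+ 2)).
  2: by ring.
have q2z := atleast_two_probability.
apply: lerD; first by apply: le_trans approx _; rewrite ler_wpM2l.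
rewrite normrM ler_pM//; first exact: fM.
exact: le_trans one q2z.
Qed.

End expansion.

(** * The generator *)

Lemma quadratic_error_slope (R : realType) (g : R -> R) (J C c : R) :
  0 < c -> 0 <= C ->
  (forall h, 0 < h -> h < c -> `|g h - h / c * J| <= (h / c) ^+ 2 * C) ->
  h^-1 * g h @[h --> 0^'+] --> c^-1 * J.
Proof.
move=> c0 C0 gP; apply/cvgrPdist_le => e e0.
have d0 : 0 < e * c ^+ 2 / (C + 1).
  by rewrite divr_gt0 ?mulr_gt0 ?exprn_gt0// ltr_wpDl.
near=> h.
have h0 : 0 < h by near: h; exact: nbhs_right_gt.
have hc : h < c by near: h; exact: nbhs_right_lt.
have hd : h < e * c ^+ 2 / (C + 1) by near: h; exact: nbhs_right_lt.
rewrite distrC.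
have -> : h^-1 * g h - c^-1 * J = h^-1 * (g h - h / c * J).
  by field; rewrite !gt_eqF.
rewrite normrM gtr0_norm ?invr_gt0// ler_pdivrMl//.
apply: le_trans (gP h h0 hc) _.
rewrite (_ : (h / c) ^+ 2 * C = h * (h * C) / c ^+ 2); last first.
  by field; rewrite gt_eqF.
rewrite ler_pdivrMr ?exprn_gt0// -mulrA ler_pM2l//.
move: hd; rewrite ltr_pdivlMr ?ltr_wpDl// => /ltW; apply: le_trans.
by rewrite ler_pM2l// lerDl.
Unshelve. all: by end_near. Qed.

Lemma jump_sum_counts (R : realType) (X : polishType R) (B : set (borel X))
    (nu : pointMeasure X) (r : seq X) (m : X -> posnat) (rho : lfMeasure X)
    (f : countMeasure -> R) :
  measurable B -> atom_decomposition B nu r m ->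
  jump_sum B nu r m rho f =
  fine (rho B) * (f (counts B nu `+` [mset posnat1])%mset - f (counts B nu)) +
  \sum_(j <- finsupp (counts B nu)) (val j)%:R * (counts B nu j)%:R *
    (f ((counts B nu `\ j) `+` [mset posnat_succ j])%mset - f (counts B nu)).
Proof.
move=> mB dec; rewrite /jump_sum big_cons big_map /=; congr (_ + _).
pose G j := (val j)%:R *
  (f ((counts B nu `\ j) `+` [mset posnat_succ j])%mset - f (counts B nu)).
rewrite -[LHS](sum_counts G mB dec); apply: eq_bigr => j _.
by rewrite mulrCA mulrA.
Qed.

Theorem corollary4p3 (R : realType) (X : polishType R)
    (S : R -> lfMeasure X -> probability (pointMeasure X) R)
    (HS : forall (z : R) (kappa : lfMeasure X),
       0 <= z < 1 -> is_polya_sum z kappa (S z kappa))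
    (rho : lfMeasure X) (rho_diffuse : diffuse rho)
    (d : measure_display) (Omega : measurableType d) (P : probability Omega R)
    (Y : R -> Omega -> pointMeasure X) (HY : is_spatial_crp S rho P Y)
    (B : set X) (HB : bounded_borel B)
    (p : R -> R -> countMeasure -> (countMeasure -> R) -> R)
    (p_markov : markov_kernel P (fun t w => counts B (Y t w)) p)
    (p_formula : is_count_kernel S rho B p) :
  forall (s : R) (f : countMeasure -> R) (eta : countMeasure),
    0 <= s < 1 -> measurable_fun setT f -> bounded_fun f ->
    (exists nu : pointMeasure X, counts B nu = eta) ->
    has_generator_at p s f eta
      (fine (rho B) / (1 - s) * (f (eta `+` [mset posnat1])%mset - f eta) +
       (1 - s)^-1 * \sum_(j <- finsupp eta) (val j)%:R * (eta j)%:R *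
         (f ((eta `\ j) `+` [mset posnat_succ j])%mset - f eta)).
Proof.
move=> s f _ /andP[s0 s1] mf bf [nu <-].
have [M0 [_ fM0]] := bf.
pose M := M0 + 1.
have fM theta : `|f theta| <= M by apply: (fM0 M) => //; rewrite ltrDl.
have [r [m dec]] := atom_decomposition_exists nu HB.
have mB : measurable (B : set (borel X)) := HB.1.
have s10 : 0 < 1 - s by rewrite subr_gt0.
set J := jump_sum B nu r m rho f.
rewrite /has_generator_at [X in _ --> X](_ : _ = (1 - s)^-1 * J); last first.
  by rewrite /J (jump_sum_counts _ _ mB dec) [RHS]mulrDr; congr (_ + _);
    rewrite mulrA [_^-1 * _]mulrC.
pose k := fine (lf_add rho nu B) + 1.
have Mge0 : 0 <= M := le_trans (normr_ge0 _) (fM mset0).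
have k0 : 0 <= k by rewrite addr_ge0// fine_ge0.
apply: (@quadratic_error_slope _ _ _ (k * `|J| + 2 * M * k ^+ 2)) => //.
  by rewrite addr_ge0// !mulr_ge0// exprn_ge0.
move=> h h0 h1.
have z01 : 0 <= h / (1 - s) < 1.
  by rewrite divr_ge0 ?(ltW h0) ?(ltW s10)//= ltr_pdivrMr// mul1r.
rewrite p_formula//; last 2 first.
- by rewrite lerDl ltW.
- by rewrite -ltrBrDl.
rewrite [s + h]addrC addrK.
have z0 : 0 <= h / (1 - s) by case/andP: z01.
exact: (polya_first_order HB dec rho_diffuse z0 (HS _ _ z01) fM).
Qed.
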